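(* Let $n,s,k,\ell$ be integers such that $\ell\ge k\ge 3$ and $1\le s<\dfrac{n}{8(k-1)^{k-2}(\ell-1)^3}$. Then $$\mathrm{ex}_k\bigl(n,\mathcal K_{\ell+1}^k\cup\{M_{s+1}^k\}\bigr)=s\,t_{k-1}(n-s,\ell-1).$$
   Context: A $k$-graph ($k$-uniform hypergraph) is a pair $(V,E)$ with $V$ finite and $E$ a set of $k$-element subsets of $V$. For a family $\mathcal F$ of $k$-graphs, a $k$-graph is $\mathcal F$-free if it contains no member of $\mathcal F$ as a subgraph; $\mathrm{ex}_k(n,\mathcal F)$ is the maximum number of edges in an $n$-vertex $\mathcal F$-free $k$-graph. $M_{s+1}^k$ is the $k$-graph consisting of $s+1$ pairwise disjoint edges. $\mathcal K_{\ell+1}^k$ is the family of all $k$-graphs $F$ with at most $\binom{\ell+1}{2}$ edges for which there exists an $(\ell+1)$-set $L$ of vertices such that every pair of vertices in $L$ is contained in some edge of $F$. For $q\ge r\ge 2$, $T_r(m,q)$ is the $r$-graph on $[m]$ obtained from a partition of $[m]$ into $q$ parts, each of size $\lfloor m/q\rfloor$ or $\lceil m/q\rceil$, whose edges are all $r$-subsets containing at most one vertex from each part; $t_r(m,q)=|E(T_r(m,q))|$. *)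

(* Defs.v *)
From mathcomp Require Import all_boot.
From mathcomp Require Import boolp.

Set Implicit Arguments.
Unset Strict Implicit.
Unset Printing Implicit Defensive.

Record hypergraph : Type := Hypergraph {
  vert : finType;
  edges : {set {set vert}}
}.

Definition uniform (k : nat) (H : hypergraph) : bool :=
  [forall e in edges H, #|e| == k].

(* [F] is, up to isomorphism, a (not necessarily induced) subgraph of [H]. *)
Definition contains (H F : hypergraph) : Prop :=
  exists f : vert F -> vert H,
    injective f /\ (forall e, e \in edges F -> f @: e \in edges H).

Definition free (Fam : hypergraph -> Prop) (H : hypergraph) : Prop :=
  forall F, Fam F -> ~ contains H F.

(* Freeness is invariant under isomorphism of the host, so it is enough to let *)
(* the [n]-vertex hosts range over those with vertex type ['I_n].              *)
Definition ex_num (k n : nat) (Fam : hypergraph -> Prop) : nat :=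
  \max_(E : {set {set 'I_n}} |
          uniform k (Hypergraph E) && `[< free Fam (Hypergraph E) >]) #|E|.

(* The [t] edges are the fibres [{i} * 'I_k]. *)
Definition matching (k t : nat) : hypergraph :=
  Hypergraph [set [set x : 'I_t * 'I_k | x.1 == i] | i in 'I_t].

Definition covers_pairs (F : hypergraph) (L : {set vert F}) : Prop :=
  forall x y, x \in L -> y \in L -> x != y ->
    exists2 e, e \in edges F & [set x; y] \subset e.

Definition clique_family (k p : nat) : hypergraph -> Prop :=
  fun F => [/\ uniform k F,
               #|edges F| <= 'C(p, 2) &
               exists2 L : {set vert F}, #|L| = p & covers_pairs L].

(* A balanced partition of ['I_m], unique up to relabelling: see               *)
(* [card_turan_part].                                                          *)
Definition turan_part (m q j : nat) : {set 'I_m} := [set i : 'I_m | i %% q == j].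

Definition turan (r m q : nat) : hypergraph :=
  Hypergraph [set e : {set 'I_m} |
    (#|e| == r) && [forall j : 'I_q, #|e :&: turan_part m q j| <= 1]].

Definition turan_number (r m q : nat) : nat := #|edges (turan r m q)|.

Lemma uniform_matching k t : uniform k (matching k t).
Proof.
apply/forall_inP => e /imsetP[i _ ->].
rewrite -[X in _ == X]card_ord -(card_imset _ (f := fun j : 'I_k => (i, j))).
  apply/eqP/eq_card => -[a b]; rewrite inE /=.
  apply/eqP/imsetP => [->|[c _ [-> _]]//]; by exists b.
by move=> a b [].
Qed.

Lemma uniform_turan r m q : uniform r (turan r m q).
Proof. by apply/forall_inP => e; rewrite inE => /andP[]. Qed.

Lemma card_turan_part m q j : j < q ->
  #|turan_part m q j| = m %/ q + (j < m %% q).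
Proof.
move=> lt_jq; have q_gt0 : 0 < q by apply: leq_ltn_trans lt_jq.
have -> : #|turan_part m q j| = \sum_(0 <= i < m | i %% q == j) 1.
  by rewrite big_mkord sum1_card; apply: eq_card => i; rewrite inE.
elim: m => [|m IHm]; first by rewrite big_geq // div0n mod0n.
rewrite big_mkcond big_nat_recr //= -big_mkcond IHm.
have lt_mq := ltn_pmod m q_gt0.
have [eq_q|neq_q] := eqVneq (m %% q).+1 q.
  have -> : m.+1 = (m %/ q).+1 * q.
    by rewrite {1}(divn_eq m q) -addnS eq_q mulSn addnC.
  rewrite mulnK // modnMl ltn0 addn0 -addnA -[RHS]addn1; congr (_ + _).
  have [->|ne] := eqVneq (m %% q) j; first by rewrite ltnn.
  suff -> : j < m %% q by [].
  by rewrite ltn_neqAle eq_sym ne -ltnS eq_q.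
have lt_q : (m %% q).+1 < q by rewrite ltn_neqAle neq_q.
have -> : m.+1 = m %/ q * q + (m %% q).+1 by rewrite addnS -divn_eq.
rewrite divnMDl // modnMDl (divn_small lt_q) (modn_small lt_q) addn0 -addnA.
congr (_ + _); rewrite ltnS [j <= _]leq_eqVlt [j == _]eq_sym.
by case: eqVneq => [->|_]; rewrite ?ltnn ?addn0.
Qed.

(* Main.v *)
(* Write r = k - 1, q = l - 1, t = t_r(n - s, q) and let D = C(n, r - 1) bound   *)
(* the number of edges through two given vertices.  By a greedy argument, at    *)
(* most s vertices are heavy, that is, have degree above k s D, and the edges   *)
(* that miss the set B of heavy vertices number at most (s - |B|) k^2 s D.      *)
(* Fix an s-set S containing B.  An edge e with e :&: S = {u} is, outside u, an *)
(* r-clique of the shadow graph in the neighbourhood of u; that neighbourhood   *)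
(* has no (q + 1)-clique, so Zykov's theorem allows at most t such edges.  If   *)
(* two heavy vertices u, v lie in a common edge, their common neighbourhood     *)
(* has no q-clique, which makes one of u, v fall short of t by s D; this pays   *)
(* for all its edges that meet S again.  As t >= (k^2 + 1) s D, summing up      *)
(* gives at most s t edges.                                                     *)

Require Import Defs.
From mathcomp Require Import all_boot all_order all_algebra.
From mathcomp Require Import boolp.
From mathcomp Require Import zify.

Set Implicit Arguments.
Unset Strict Implicit.
Unset Printing Implicit Defensive.

(** * Rainbow sets and cones *)

(** Write [r] for k - 1 and [q] for l - 1. Lower bound: [turan_cone] joins each of [s] core vertices
    to every edge of the Turan [r]-graph with [q] classes on the other vertices. Every edge uses a
    core vertex, so [s.+1] edges cannot be disjoint. Giving the whole core one extra colour makes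
    every edge rainbow in [q.+1] colours, so no [q.+2] vertices are pairwise covered.

    Upper bound ([card_edges_le]): a vertex whose degree is large compared with the codegree bound
    [D] can always extend a matching. Hence there are at most [s] heavy vertices, and few edges miss
    them all ([card_heavy], [card_light]). In a core of [s] vertices containing the heavy ones, the
    edges meeting the core only in [u] are cliques of the shadow graph inside the neighbourhood of
    [u], and [zykov] bounds them by a Turan number [t]. Edges with two heavy vertices are paid for
    by a deficit at one of the two ([own_lossy]).

    The size of [n] enters through three inequalities, [turan_number_ge_codegree],
    [turan_number_gap_ge] and [turan_number_sub_ge]: [t] has order n^r while [D] has order n^(r-1),
    so [t] and its relevant differences dominate multiples of [s * D]. *)

Definition rainbow (T : finType) (col : T -> nat) (e : {set T}) : bool :=
  [forall x in e, forall y in e, (col x == col y) ==> (x == y)].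

Lemma rainbowP (T : finType) (col : T -> nat) (e : {set T}) :
  reflect {in e &, injective col} (rainbow col e).
Proof.
apply: (iffP forall_inP) => [inj x y ex ey /eqP exy | inj x ex].
  by move/forall_inP: (inj x ex) => /(_ y ey)/implyP/(_ exy)/eqP.
by apply/forall_inP => y ey; apply/implyP => /eqP/inj-/(_ ex ey)/eqP.
Qed.

Lemma rainbow_cone (T : finType) (col : T -> nat) (x : T) (e : {set T}) :
  rainbow col e -> (forall y, y \in e -> col y != col x) ->
  rainbow col (x |: e).
Proof.
move=> /rainbowP inj ne; apply/rainbowP => y z /setU1P[->|ye] /setU1P[->|ze] //.
- by move/esym/eqP; rewrite (negPf (ne z ze)).
- by move/eqP; rewrite (negPf (ne y ye)).
exact: inj.
Qed.

Lemma in_turan r m q (e : {set 'I_m}) :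
  (e \in edges (turan r m q)) =
  (#|e| == r) && rainbow (fun i : 'I_m => i %% q) e.
Proof.
rewrite inE; congr (_ && _); apply/forallP/rainbowP => [le1 x y ex ey exy|inj j].
  have [q0|q_gt0] := posnP q.
    by apply: val_inj; move: exy; rewrite q0 !modn0.
  have := le1 (Ordinal (ltn_pmod x q_gt0)) => /card_le1_eqP inj; apply: inj.
    by rewrite !inE ey /= exy.
  by rewrite !inE ex /=.
apply/card_le1_eqP => y x; rewrite !inE => /andP[ey /eqP jy] /andP[ex /eqP jx].
by apply: inj; rewrite ?jx ?jy.
Qed.

Lemma card_cone (T : finType) (A : {set T}) (E : {set {set T}}) :
  (forall e, e \in E -> [disjoint A & e]) ->
  #|[set x |: e | x in A, e in E]| = #|A| * #|E|.
Proof.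
move=> dis; rewrite -cardsX curry_imset2X card_in_imset //.
move=> [x e] [y f] /setXP[/= Ax Ee] /setXP[/= Ay Ef] /= exf.
have xf : (x \in f) = false by apply: (disjointFr (dis f Ef)).
have ye : (y \in e) = false by apply: (disjointFr (dis e Ee)).
have xy : x = y by have /setP/(_ x) := exf; rewrite !inE eqxx xf orbF => /esym/eqP.
subst y; congr (_, _); apply/setP => z; have /setP/(_ z) := exf; rewrite !inE.
by have [->|//] := eqVneq z x; rewrite xf ye.
Qed.


Lemma leq_card_bigcup (I T : finType) (P : {set I}) (F : I -> {set T}) c :
  {in P, forall i, #|F i| <= c} -> #|\bigcup_(i in P) F i| <= #|P| * c.
Proof.
move=> le_c; rewrite -sum_nat_const.
apply: (@leq_trans (\sum_(i in P) #|F i|)); last exact: leq_sum.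
elim/big_ind2: _ => [|a b A B le_A le_B|//]; first by rewrite cards0.
by rewrite (leq_trans (leq_card_setU _ _)) // leq_add.
Qed.

(** * Turan numbers *)

Lemma rainbow_imset (aT rT : finType) (f : aT -> rT) (col : rT -> nat)
    (col' : aT -> nat) (e : {set aT}) :
  (forall x y, col (f x) = col (f y) -> col' x = col' y) ->
  rainbow col' e -> rainbow col (f @: e).
Proof.
move=> cf /rainbowP inj; apply/rainbowP => _ _ /imsetP[x ex ->] /imsetP[y ey ->].
by move/cf/(inj x y ex ey) ->.
Qed.

Lemma widen_ord_inj m n (le_mn : m <= n) : injective (widen_ord le_mn).
Proof. by move=> i j /(congr1 val)/= /val_inj. Qed.

Lemma leq_turan_number r q : {homo (fun m => turan_number r m q) : m n / m <= n}.
Proof.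
move=> m n le_mn; have inj := @widen_ord_inj m n le_mn.
rewrite /turan_number -(card_imset _ (imset_inj inj)) subset_leq_card //.
apply/subsetP => _ /imsetP[e + ->]; rewrite !in_turan card_imset // => /andP[-> /=].
exact: rainbow_imset.
Qed.

Lemma turan_number0 m q : turan_number 0 m q = 1.
Proof.
rewrite -(cards1 (set0 : {set 'I_m})); apply: eq_card => e.
rewrite in_turan in_set1 cards_eq0; have [->|//] := eqVneq e set0.
by apply/rainbowP => x y; rewrite inE.
Qed.

(* The new vertex [m] lies in the class [c] of [m] modulo [q.+1], and [phi]    *)
(* enumerates the vertices below [m] outside of that class.                    *)
Lemma turan_number_rec r m q :
  turan_number r.+1 m q.+1 + turan_number r (m - m %/ q.+1) q
    <= turan_number r.+1 m.+1 q.+1.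
Proof.
pose c := m %% q.+1; pose M := m - m %/ q.+1.
have eq_m : m = m %/ q.+1 * q.+1 + c by exact: divn_eq.
have le_c : c <= q by rewrite -ltnS ltn_pmod.
have eq_M : M = m %/ q.+1 * q + c by rewrite /M; nia.
pose phi j := j %/ q * q.+1 + bump c (j %% q).
have lt_bump j : j < M -> bump c (j %% q) < q.+1.
  move=> lt_j; have [q0|q_gt0] := posnP q; first by nia.
  by rewrite /bump; have := ltn_pmod j q_gt0; case: leq; lia.
have lt_phi j : j < M -> phi j < m.
  move=> lt_j; have [q0|q_gt0] := posnP q; first by nia.
  have lt_b := lt_bump j lt_j; have lt_jq := ltn_pmod j q_gt0.
  have jE := divn_eq j q; rewrite /phi.
  have [lt_a|ge_a] := ltnP (j %/ q) (m %/ q.+1).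
    by move: lt_b; set b := bump _ _; nia.
  have eq_a : j %/ q = m %/ q.+1.
    by apply/eqP; rewrite eqn_leq ge_a andbT -ltnS ltn_divLR //; nia.
  have lt_jc : j %% q < c by nia.
  by rewrite /bump [c <= _]leqNgt lt_jc add0n eq_a [X in _ < X]eq_m ltn_add2l.
have phi_mod j : j < M -> phi j %% q.+1 = bump c (j %% q).
  by move=> lt_j; rewrite /phi modnMDl modn_small ?lt_bump.
pose f (j : 'I_M) : 'I_m.+1 := Ordinal (leqW (lt_phi j (ltn_ord j))).
have fE (j : 'I_M) : f j = phi j :> nat by [].
have f_mod (i j : 'I_M) : f i = f j %[mod q.+1] -> i = j %[mod q].
  by rewrite /= !phi_mod // => /(can_inj (@bumpK c)).
have f_inj : injective f.
  move=> i j eq_f; have eq_mod : i = j %[mod q] by apply: f_mod; rewrite eq_f.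
  apply: val_inj; rewrite /= (divn_eq i q) (divn_eq j q) eq_mod; congr (_ * _ + _).
  have := congr1 val eq_f; rewrite /= /phi eq_mod => /eqP.
  by rewrite eqn_add2r eqn_pmul2r // => /eqP.
have w_inj := @widen_ord_inj m m.+1 (leqnSn m).
pose E1 := [set widen_ord (leqnSn m) @: (e : {set 'I_m}) | e in edges (turan r.+1 m q.+1)].
pose E2 := [set f @: (e : {set 'I_M}) | e in edges (turan r M q)].
have E1_max e : e \in E1 -> ord_max \notin e.
  case/imsetP => e' _ ->; apply/imsetP => -[i _ /(congr1 val)/= eq_i].
  by have := ltn_ord i; rewrite -eq_i ltnn.
have E2_mod e (x : 'I_m.+1) : e \in E2 -> x \in e -> x %% q.+1 != c.
  case/imsetP => e' _ -> /imsetP[j _ ->]; rewrite /= phi_mod //.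
  by rewrite eq_sym neq_bump.
have E2_max e : e \in E2 -> ord_max \notin e.
  by move=> eE; apply: contraTN isT => /(E2_mod _ _ eE)/=; rewrite eqxx.
pose E3 := [set x |: (e : {set _}) | x in [set ord_max : 'I_m.+1], e in E2].
have card1 : #|E1| = turan_number r.+1 m q.+1.
  by rewrite card_imset //; exact: imset_inj.
have card3 : #|E3| = turan_number r M q.
  rewrite card_cone => [|e eE]; last by rewrite disjoints1 E2_max.
  by rewrite cards1 mul1n card_imset //; exact: imset_inj.
rewrite -/M -card1 -card3 -cardsUI.
have -> : E1 :&: E3 = set0.
  apply/setP => e; rewrite !inE; apply: contraTF isT => /andP[/E1_max ne].
  by case/imset2P => _ e' /set1P -> _ eE; rewrite eE setU11 in ne.
rewrite cards0 addn0 subset_leq_card // subUset; apply/andP; split.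
  apply/subsetP => _ /imsetP[e + ->]; rewrite !in_turan card_imset // => /andP[-> /=].
  exact: rainbow_imset.
apply/subsetP => _ /imset2P[_ e /set1P-> eE ->]; have := eE => /imsetP[e' + eq_e].
rewrite !in_turan cardsU1 E2_max // => /andP[/eqP card_e' rain].
rewrite {1}eq_e card_imset // card_e' add1n eqxx /=.
apply: rainbow_cone => [|y ye]; last exact: E2_mod eE ye.
by rewrite eq_e; apply: rainbow_imset rain.
Qed.

(** * Zykov's theorem *)

Definition clique (T : finType) (adj : rel T) (L : {set T}) : bool :=
  [forall x in L, forall y in L, (x != y) ==> adj x y].

Definition cliques (T : finType) (adj : rel T) (A : {set T}) (r : nat) :=
  [set e : {set T} | [&& e \subset A, #|e| == r & clique adj e]].

Lemma cliqueP (T : finType) (adj : rel T) (L : {set T}) :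
  reflect {in L &, forall x y, x != y -> adj x y} (clique adj L).
Proof.
apply: (iffP forall_inP) => [cl x y Lx Ly | cl x Lx].
  by move/forall_inP: (cl x Lx) => /(_ y Ly)/implyP.
by apply/forall_inP => y Ly; apply/implyP; exact: cl.
Qed.

Lemma cliqueS (T : finType) (adj : rel T) (L L' : {set T}) :
  L \subset L' -> clique adj L' -> clique adj L.
Proof.
by move=> /subsetP sL /cliqueP cl; apply/cliqueP => x y /sL Lx /sL Ly; exact: cl.
Qed.

Lemma cliqueU1 (T : finType) (adj : rel T) (x : T) (L : {set T}) :
  symmetric adj -> {in L, forall y, adj x y} -> clique adj L ->
  clique adj (x |: L).
Proof.
move=> sym ad /cliqueP cl; apply/cliqueP => y z /setU1P[->|Ly] /setU1P[->|Lz].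
- by rewrite eqxx.
- by move=> _; exact: ad.
- by move=> _; rewrite sym; exact: ad.
exact: cl.
Qed.

Section Zykov.
Variables (T : finType) (adj : rel T).
Hypothesis adj_sym : symmetric adj.
Implicit Types (A L : {set T}) (x y : T).

Definition nbhd A x := [set y in A | (y != x) && adj x y].

(** Each chosen vertex rules out at most [c] vertices of [A], itself included, so a further vertex
    is available as long as at most [q] have been chosen. *)
Lemma greedy_clique A c q :
  {in A, forall x, #|A :\: nbhd A x| <= c} -> q * c < #|A| ->
  exists L, [/\ L \subset A, #|L| = q.+1 & clique adj L].
Proof.
move=> few lt_qc; suff: forall j, j <= q.+1 ->
  exists L, [/\ L \subset A, #|L| = j & clique adj L] by exact.
elim=> [_ | j IHj lt_j].
  exists set0; rewrite sub0set cards0; split=> //.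
  by apply/cliqueP => x y; rewrite inE.
have [L [sLA card_L cl]] := IHj (ltnW lt_j).
pose U := \bigcup_(x in L) (A :\: nbhd A x).
have card_U : #|U| <= j * c.
  rewrite -card_L; apply: leq_card_bigcup => x Lx.
  by apply: few; exact: (subsetP sLA).
have [y yA yU] : exists2 y, y \in A & y \notin U.
  apply/subsetPn; apply: contraTN lt_qc => /subset_leq_card le_AU.
  rewrite -leqNgt (leq_trans le_AU) // (leq_trans card_U) // leq_mul2r.
  by rewrite -ltnS lt_j orbT.
have nyL x : x \in L -> (y != x) && adj x y.
  move=> Lx; apply: contraNT yU => nad; apply/bigcupP; exists x => //.
  by rewrite !inE yA andbT.
exists (y |: L); split; first by rewrite subUset sub1set yA.
  by rewrite cardsU1 card_L; case: (boolP (y \in L)) => [/nyL|//]; rewrite eqxx.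
by apply: cliqueU1 => // x /nyL /andP[_]; rewrite adj_sym.
Qed.

Lemma card_cliques_rec A x r : x \in A ->
  #|cliques adj A r.+1| <=
    #|cliques adj (A :\ x) r.+1| + #|cliques adj (nbhd A x) r|.
Proof.
move=> Ax; pose E := [set x |: (e : {set T}) | e in cliques adj (nbhd A x) r].
apply: leq_trans (_ : #|cliques adj (A :\ x) r.+1 :|: E| <= _); last first.
  by rewrite (leq_trans (leq_card_setU _ _)) // leq_add2l leq_imset_card.
apply/subset_leq_card/subsetP => e; rewrite !inE => /and3P[sA card_e cl].
have [xe|xe] := boolP (x \in e); last by rewrite subsetD1 sA card_e cl xe.
apply/orP; right; apply/imsetP; exists (e :\ x); last by rewrite setD1K.
rewrite inE (cliqueS _ cl) ?subD1set // andbT; apply/andP; split; last first.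
  by move: card_e; rewrite (cardsD1 x) xe.
apply/subsetP => y /setD1P[ne ye]; rewrite inE ne (subsetP sA) //=.
by move/cliqueP: cl; apply=> //; rewrite eq_sym.
Qed.

(* Induction on the number of vertices, removing a vertex of small degree,     *)
(* which exists because a large minimum degree would make the greedy algorithm *)
(* find a clique with [q.+1] vertices.                                         *)
Lemma zykov q r A :
  (forall L, L \subset A -> clique adj L -> #|L| <= q) ->
  #|cliques adj A r| <= turan_number r #|A| q.
Proof.
have [m] := ubnP #|A|; elim: m => // m IHm in q r A *; rewrite ltnS => le_m free_A.
case: r => [|r].
  rewrite turan_number0 -(cards1 (set0 : {set T})); apply/subset_leq_card/subsetP.
  by move=> e; rewrite !inE => /and3P[_]; rewrite cards_eq0.
have [A0|[x0 Ax0]] := set_0Vmem A.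
  suff -> : cliques adj A r.+1 = set0 by rewrite cards0.
  apply/setP => e; rewrite !inE A0 subset0; apply/and3P => -[/eqP->].
  by rewrite cards0.
have clique1 x : clique adj [set x].
  by apply/cliqueP => y z /set1P -> /set1P ->; rewrite eqxx.
case: q free_A => [|q] free_A.
  by have := free_A [set x0]; rewrite sub1set Ax0 cards1 clique1 => /(_ isT isT).
have := cardsD1 x0 A; rewrite Ax0 add1n; set M := #|A :\ x0| => card_A.
have [x Ax deg_x] : exists2 x, x \in A & #|nbhd A x| <= M - M %/ q.+1.
  apply/exists_inP; apply: contraT => /exists_inPn big.
  have [||L [sL card_L cl]] := @greedy_clique A (M %/ q.+1) q.+1.
  - move=> x Ax; move/(_ x Ax): big; rewrite -ltnNge => big.
    have sN : nbhd A x \subset A by apply/subsetP => y; rewrite inE => /andP[].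
    have le_d : M %/ q.+1 <= M by exact: leq_div.
    by rewrite cardsDS // card_A; move: le_d big; set d := _ %/ _; lia.
  - by rewrite card_A ltnS mulnC leq_trunc_div.
  by have := free_A L sL cl; rewrite card_L ltnn.
have card_Ax : #|A :\ x| = M by have := cardsD1 x A; rewrite Ax card_A => -[].
apply: leq_trans (card_cliques_rec r Ax) _.
rewrite card_A; apply: leq_trans (turan_number_rec r M q); apply: leq_add.
  rewrite -card_Ax; apply: IHm => [|L sL]; first by rewrite card_Ax -card_A.
  by apply: free_A; rewrite (subset_trans sL) // subD1set.
apply: leq_trans (leq_turan_number r q deg_x).
have sN : nbhd A x \subset A :\ x.
  by apply/subsetP => y; rewrite !inE => /andP[-> /andP[->]].
apply: IHm => [|L sL cl].
  by rewrite (leq_ltn_trans (subset_leq_card sN)) // card_Ax -card_A.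
have xL : x \notin L by apply: contraL isT => /(subsetP sL); rewrite !inE eqxx andbF.
(* [xL] turns [true] into [x \notin L], so that [cardsU1] applies: [x] enlarges every clique of its
   neighbourhood, which saves one in the clique bound. *)
rewrite -ltnS -[#|L|.+1]/(true + #|L|) -[true]xL -cardsU1; apply: free_A.
  by rewrite subUset sub1set Ax (subset_trans sL) // (subset_trans sN) // subD1set.
by apply: cliqueU1 => // y /(subsetP sL); rewrite inE => /and3P[].
Qed.

End Zykov.

(** * Lower bounds for Turan numbers *)

Lemma leq_card_rainbow (T : finType) (col : T -> nat) (L : {set T}) q :
  rainbow col L -> {in L, forall x, col x < q} -> #|L| <= q.
Proof.
move=> /rainbowP inj lt_q; have := size_iota 0 q; rewrite cardE -(size_map col).
move=> <-; apply: uniq_leq_size.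
  by rewrite map_inj_in_uniq ?enum_uniq // => x y; rewrite !mem_enum; exact: inj.
move=> _ /mapP[x + ->]; rewrite mem_enum mem_iota; exact: lt_q.
Qed.

Lemma turan_number_rainbow (T : finType) (col : T -> nat) (A : {set T}) r q
    (E : {set {set T}}) :
  {in A, forall x, col x < q} ->
  {in E, forall e : {set T}, [&& e \subset A, #|e| == r & rainbow col e]} ->
  #|E| <= turan_number r #|A| q.
Proof.
move=> lt_q rE; pose adj x y := col x != col y.
have cl_r e : clique adj e = rainbow col e.
  apply/cliqueP/rainbowP => [cl x y ex ey /eqP|inj x y ex ey].
    by have [//|/(cl x y ex ey)/negPf->] := eqVneq x y.
  by apply: contraNneq => /inj->.
have adj_sym : symmetric adj by move=> x y; rewrite /adj eq_sym.
apply: (@leq_trans #|cliques adj A r|); last first.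
  apply: zykov => // L sL; rewrite cl_r => rL.
  by apply: leq_card_rainbow rL _ => x /(subsetP sL); exact: lt_q.
by apply/subset_leq_card/subsetP => e /rE; rewrite inE cl_r.
Qed.

Definition rainbows (T : finType) (col : T -> nat) p r :=
  [set e : {set T} | [&& #|e| == r, rainbow col e & [forall x in e, col x < p]]].

(** Pascal's rule: a rainbow set either avoids the last colour or is a cone whose apex has that
    colour. *)
Lemma card_rainbows_ge (T : finType) (col : T -> nat) p r a :
  (forall j, j < p -> a <= #|[set x | col x == j]|) ->
  'C(p, r) * a ^ r <= #|rainbows col p r|.
Proof.
elim: p r => [|p IHp] [|r] le_a; rewrite ?bin0n ?mul0n //.
- rewrite card_gt0; apply/set0Pn; exists set0; rewrite inE cards0 eqxx /=.
  by apply/andP; split; [apply/rainbowP | apply/forall_inP] => x; rewrite inE.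
- rewrite bin0 card_gt0; apply/set0Pn; exists set0; rewrite inE cards0 eqxx /=.
  by apply/andP; split; [apply/rainbowP | apply/forall_inP] => x; rewrite inE.
have le_a' j : j < p -> a <= #|[set x | col x == j]| by move=> /ltnW; exact: le_a.
pose A := [set x | col x == p].
pose E := [set x |: (e : {set T}) | x in A, e in rainbows col p r].
have cE : #|E| = #|A| * #|rainbows col p r|.
  apply: card_cone => e; rewrite inE => /and3P[_ _ /forall_inP lt_p].
  rewrite disjoint_sym disjoint_subset; apply/subsetP => x /lt_p.
  by rewrite !inE ltn_neqAle => /andP[].
rewrite binS mulnDl [X in _ + _ * X]expnS [X in _ + X]mulnCA.
apply: (@leq_trans (#|rainbows col p r.+1| + #|E|)).
  by rewrite cE leq_add ?IHp // leq_mul ?IHp // le_a.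
rewrite -cardsUI; have -> : rainbows col p r.+1 :&: E = set0.
  apply/setP => e; rewrite !inE; apply: contraTF isT => /andP[/and3P[_ _ /forall_inP lt_p]].
  case/imset2P => x e'; rewrite inE => /eqP col_x _ eq_e.
  by have := lt_p x; rewrite eq_e setU11 col_x ltnn => /(_ isT).
rewrite cards0 addn0 subset_leq_card // subUset; apply/andP; split.
  apply/subsetP => e; rewrite !inE => /and3P[-> -> /forall_inP lt_p] /=.
  by apply/forall_inP => x /lt_p/leqW.
apply/subsetP => _ /imset2P[x e Ax eE ->]; move: Ax eE; rewrite !inE.
move=> /eqP col_x /and3P[/eqP card_e rain /forall_inP lt_p].
have ne y : y \in e -> col y != col x.
  by move=> /lt_p; rewrite col_x ltn_neqAle => /andP[].
have xe : x \notin e by apply: contraL isT => /ne; rewrite eqxx.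
rewrite cardsU1 xe card_e add1n eqxx rainbow_cone //=.
by apply/forall_inP => y /setU1P[->|/lt_p/leqW]; rewrite ?col_x.
Qed.

Lemma card_turan_part_ge m q j : j < q -> m %/ q <= #|turan_part m q j|.
Proof. by move/card_turan_part->; exact: leq_addr. Qed.

Lemma turan_number_ge r m q : 0 < q -> 'C(q, r) * (m %/ q) ^ r <= turan_number r m q.
Proof.
move=> q_gt0; pose col (i : 'I_m) := i %% q.
apply: (@leq_trans #|rainbows col q r|).
  by apply: card_rainbows_ge => j; exact: card_turan_part_ge.
apply/subset_leq_card/subsetP => e; rewrite in_turan inE.
by move=> /and3P[-> -> _].
Qed.

(* Split the last class of [turan r m p] into two halves of size at least      *)
(* [m %/ p.*2] and add the edges that meet both.                               *)
Lemma turan_number_gap r m p : 0 < p ->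
  turan_number r.+2 m p + (m %/ p.*2) ^ 2 * ('C(p.-1, r) * (m %/ p) ^ r)
    <= turan_number r.+2 m p.+1.
Proof.
(* The class of [p.-1] modulo [p] splits into the residues [p.-1] and [p.*2.-1] modulo [p.*2]; the
   latter gets the new colour [p]. *)
move=> p_gt0; pose half i := i %% p.*2 == p.*2.-1.
pose col (i : 'I_m) := if half i then p else i %% p.
have mod_half i : i %% p.*2 %% p = i %% p by rewrite modn_dvdm // -muln2 dvdn_mulr.
have halfE i : half i -> i %% p = p.-1.
  move/eqP => eq_i; rewrite -mod_half eq_i.
  by rewrite (_ : p.*2.-1 = p + p.-1) ?modnDl ?modn_small //; lia.
have col_mod (i j : 'I_m) : col i = col j -> i = j %[mod p].
  have := ltn_pmod i p_gt0; have := ltn_pmod j p_gt0; rewrite /col.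
  by case: ifP => [/halfE->|_]; case: ifP => [/halfE->|_] //; lia.
pose A := turan_part m p.*2 p.*2.-1; pose B := turan_part m p.*2 p.-1.
have colA x : x \in A -> col x = p by rewrite inE /col /half => ->.
have colB x : x \in B -> col x = p.-1.
  rewrite inE /col /half => /eqP eq_x; rewrite eq_x -mod_half eq_x.
  by rewrite [p.-1 %% p]modn_small ?ifF //; [apply/eqP|]; lia.
have modA x : x \in A -> x %% p = p.-1 by rewrite inE; exact: halfE.
have modB x : x \in B -> x %% p = p.-1.
  by rewrite inE => /eqP eq_x; rewrite -mod_half eq_x modn_small //; lia.
pose mp (i : 'I_m) := i %% p.
pose E0 := rainbows mp p.-1 r.
pose E1 := [set x |: (e : {set 'I_m}) | x in B, e in E0].
pose E2 := [set x |: (e : {set 'I_m}) | x in A, e in E1].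
have E0_mod e y : e \in E0 -> y \in e -> y %% p < p.-1.
  by rewrite inE => /and3P[_ _ /forall_inP]; apply.
have col0 e y : e \in E0 -> y \in e -> col y = y %% p.
  move=> eE ye; rewrite /col; case: ifP => // /halfE eq_y.
  by have := E0_mod e y eE ye; rewrite eq_y ltnn.
have col_lt e y : e \in E0 -> y \in e -> col y < p.-1.
  by move=> eE ye; rewrite (col0 e) // (E0_mod e).
have disB e : e \in E0 -> [disjoint B & e].
  move=> eE; rewrite disjoint_sym disjoint_subset; apply/subsetP => y ye.
  by rewrite inE; apply/negP => /modB; have := E0_mod e y eE ye => /ltn_eqF/eqP.
have disA e : e \in E1 -> [disjoint A & e].
  case/imset2P => x e' xB eE ->; rewrite disjoint_sym disjoint_subset.
  apply/subsetP => y /setU1P[->|ye]; rewrite inE; apply/negP.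
    by move/colA/eqP; rewrite colB // ltn_eqF ?ltn_predL.
  by move/modA/eqP; rewrite ltn_eqF ?(E0_mod e').
have card0 : 'C(p.-1, r) * (m %/ p) ^ r <= #|E0|.
  apply: card_rainbows_ge => j lt_j; apply: card_turan_part_ge; lia.
have card2 : (m %/ p.*2) ^ 2 * ('C(p.-1, r) * (m %/ p) ^ r) <= #|E2|.
  rewrite !card_cone // -mulnn -mulnA.
  by do 2![apply: leq_mul; first by apply: card_turan_part_ge; lia].
apply: (@leq_trans (#|edges (turan r.+2 m p)| + #|E2|)); first by rewrite leq_add2l.
(* The sets in [E2] are new, since both of their apexes lie in one class modulo [p]. *)
rewrite -cardsUI; have -> : edges (turan r.+2 m p) :&: E2 = set0.
  apply/setP => e; rewrite in_setI in_set0 in_turan; apply/negP.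
  case/andP => /andP[_ /rainbowP inj] /imset2P[x e' Ax /imset2P[y e'' By _ eq_e'] eq_e].
  have xy : x = y.
    by apply: inj; rewrite /= ?(modA x) ?(modB y) // eq_e ?setU11 // eq_e' !inE eqxx orbT.
  by move/eqP: (colA x Ax); rewrite xy colB // ltn_eqF ?ltn_predL.
rewrite cards0 addn0.
have -> : turan_number r.+2 m p.+1 = turan_number r.+2 #|[set: 'I_m]| p.+1.
  by rewrite cardsT card_ord.
apply: (@turan_number_rainbow _ col) => [i _|e].
  by rewrite /col; case: ifP => // _; have := ltn_pmod i p_gt0; lia.
rewrite subsetT /= => /setUP[|].
  rewrite in_turan => /andP[-> /rainbowP inj]; apply/rainbowP => x y ex ey /col_mod.
  exact: inj.
case/imset2P => x e' xA eE ->; have xe' : x \notin e'.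
  by rewrite (disjointFr (disA _ eE)).
case/imset2P: (eE) => y e'' yB eE0 eq_e'; have ye'' : y \notin e''.
  by rewrite (disjointFr (disB _ eE0)).
have rain0 : rainbow col e''.
  have := eE0; rewrite inE => /and3P[_ /rainbowP inj _].
  apply/rainbowP => z t ez et; rewrite !(col0 e'') //; exact: inj.
have rain1 : rainbow col e'.
  rewrite eq_e'; apply: rainbow_cone => // z ze.
  by rewrite (colB y) // neq_ltn (col_lt e'').
have := eE0; rewrite inE => /andP[/eqP card_e'' _].
rewrite cardsU1 xe' eq_e' cardsU1 ye'' card_e'' -eq_e' !add1n eqxx /=.
apply: rainbow_cone => // z; rewrite (colA x) // eq_e' => /setU1P[->|ze].
  by rewrite colB // neq_ltn ltn_predL p_gt0.
by rewrite neq_ltn (leq_trans (col_lt _ _ eE0 ze)) ?leq_pred.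
Qed.

(** * Numerical estimates *)

Lemma leq_exp2rW e : {homo expn^~ e : m n / m <= n}.
Proof. by case: e => // e m n le_mn; rewrite leq_exp2r. Qed.

(** A shifted form of (v/u)^u <= C(v,u). The shift [z] absorbs the rounding of class sizes: each
    factor (v+1)/(u+1) of the binomial only decreases when [z] is added to numerator and
    denominator. *)
Lemma bin_exp_ge u v z : u <= v -> (v + z) ^ u <= 'C(v, u) * (u + z) ^ u.
Proof.
elim: u v z => [|u IHu] [|v] z // le_uv; rewrite ?bin0 // -(leq_pmul2l (ltn0Sn u)).
rewrite mulnA -(mul_bin_diag v.+1) -mulnA !addSnnS !expnS /=.
have le_lin : u.+1 * (v + z.+1) <= v.+1 * (u + z.+1) by nia.
rewrite mulnA (leq_trans (leq_mul le_lin (IHu v z.+1 le_uv))) //.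
by rewrite -!mulnA [X in _ * X]mulnCA.
Qed.

(** Multiply the factorial by its reversal: each product (i+1)(n-i) is at least n. *)
Lemma fact_sqr_ge n : n ^ n <= n`! ^ 2.
Proof.
have rev : n`! = \prod_(0 <= i < n) (n - i).
  rewrite fact_prod big_add1 big_nat_rev /=; apply: eq_big_nat => i /andP[_ lt_i].
  by lia.
rewrite expnS expn1 {2}rev fact_prod big_add1 /= -big_split /=.
have -> : n ^ n = \prod_(0 <= i < n) n by rewrite prod_nat_const_nat subn0.
rewrite !big_mkord; apply: leq_prod => i _; have := ltn_ord i; nia.
Qed.

Lemma fact_le_exp n : n.+1`! <= n.+2 ^ n.
Proof.
elim: n => // n IHn; rewrite factS expnSr mulnC leq_mul //.
by rewrite (leq_trans IHn) // leq_exp2rW.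
Qed.

Lemma expS_le_exp r : 0 < r -> r.+1 ^ r.-1 <= r ^ r.
Proof.
(* A form of Bernoulli's inequality, (1 + 1/r)^j (1 - j/r) <= 1, to be taken at j = r - 1. *)
move=> r_gt0; suff bern j : j < r -> r.+1 ^ j * (r - j) <= r ^ j.+1.
  have := bern r.-1; rewrite prednK // (_ : r - r.-1 = 1); last by lia.
  by rewrite muln1; apply.
elim: j => [|j IHj] lt_j; first by rewrite subn0 mul1n expn1.
rewrite expnSr [X in _ <= X]expnSr -mulnA.
have le_lin : r.+1 * (r - j.+1) <= (r - j) * r by nia.
apply: (leq_trans (leq_mul (leqnn _) le_lin)).
by rewrite mulnA leq_mul2r IHj ?orbT // ltnW.
Qed.

Lemma bin_fact_le_exp n i : 'C(n, i) * i`! <= n ^ i.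
Proof.
rewrite bin_ffact; elim: i => // i IHi; rewrite ffactnSr expnSr; apply: leq_mul => //.
exact: leq_subr.
Qed.

(** By [turan_number_rec] each added vertex brings a Turan number with [q.-1] classes, of size at
    least [m %/ q] each. *)
Lemma turan_number_addn r m q y : 1 < q ->
  turan_number r.+1 m q + y * ('C(q.-1, r) * (m %/ q) ^ r)
    <= turan_number r.+1 (m + y) q.
Proof.
case: q => [|[|p]] // _; elim: y => [|y IHy]; first by rewrite mul0n !addn0.
rewrite addnS; apply: leq_trans (turan_number_rec _ _ _).
rewrite mulSnr addnA leq_add //; set m1 := m + y.
apply: leq_trans (turan_number_ge _ _ _) => //.
rewrite /= leq_mul2l leq_exp2rW ?orbT //.
rewrite leq_divRL // (leq_trans (n := m1 %/ p.+2 * p.+1)) //.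
  by rewrite leq_mul2r leq_div2r ?orbT // leq_addr.
have := leq_trunc_div m1 p.+2; rewrite mulnS; lia.
Qed.

(** Enlarging the denominator from [q] to [q.+1] pays for both the loss of [x] vertices and the
    rounding. *)
Lemma leq_divn_succ n x q :
  0 < q -> q.+1 * (x + q) <= n -> n <= (n - x) %/ q * q.+1.
Proof.
move=> q_gt0 le_n; have := divn_eq (n - x) q; have := ltn_pmod (n - x) q_gt0.
move: (_ %/ _) (_ %% _) => c d lt_d eq_c; rewrite -(leq_pmul2r q_gt0).
have : n * q <= q.+1 * (n - (x + q)) by rewrite mulnBr; lia.
move=> /leq_trans; apply; rewrite mulnAC mulnC leq_mul //; lia.
Qed.

(** The analogue for half classes: 1/(q-1) = (q+1)/(q^2-1) exceeds (q+1)/q^2, and the slack pays for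
    [s] and the rounding. *)
Lemma leq_divn_double n s q : 1 < q -> q ^ 2 * (s + q.*2) <= n ->
  q.+1 * n <= ((n - s) %/ q.-1.*2).*2 * q ^ 2.
Proof.
case: q => [|[|p]] // _; set q := p.+2 => le_n; rewrite /= -[p.+1]/q.-1.
have q_gt1 : 1 < q by [].
have [n' eq_n] : exists n', n = n' + (s + q.-1.*2).
  exists (n - (s + q.-1.*2)); rewrite subnK // (leq_trans _ le_n) //.
  by rewrite expnS expn1; nia.
have le_alpha : n' <= ((n - s) %/ q.-1.*2).*2 * q.-1.
  have p2_gt0 : 0 < q.-1.*2 by [].
  have := divn_eq (n - s) q.-1.*2; have := ltn_pmod (n - s) p2_gt0.
  move: (_ %/ _) (_ %% _) => a b; rewrite eq_n; lia.
have qp_gt0 : 0 < q.-1 by [].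
rewrite -(leq_pmul2r qp_gt0); apply: (@leq_trans (n' * q ^ 2)).
  have : q ^ 2 * (s + q.-1.*2) <= n by rewrite (leq_trans _ le_n) // leq_mul2l; lia.
  rewrite mulnAC (_ : q.+1 * q.-1 = q ^ 2 - 1 ^ 2); last first.
    by rewrite subn_sqr subn1 addn1 mulnC.
  rewrite mulnBl mul1n {1}eq_n mulnDr mulnC; move: (q ^ 2 * _) => X; lia.
by rewrite [X in _ <= X]mulnAC leq_mul2r le_alpha orbT.
Qed.

(** * The three inequalities that the upper bound needs from the size of n *)

Section Estimates.
Variables (n s i q : nat).
Let r := i.+2.
Let D := 'C(n, r.-1).
Let F := r.-1`!.
Hypotheses (le_rq : r <= q) (s_gt0 : 0 < s) (lt_n : 8 * r ^ r.-1 * q ^ 3 * s < n).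

Let F_gt0 : 0 < F. Proof. exact: fact_gt0. Qed.

Let DF_le : D * F <= n ^ r.-1. Proof. exact: bin_fact_le_exp. Qed.

Let R_ge2 : 2 <= r ^ r.-1.
Proof. by rewrite /r /= expnS; have := expn_gt0 i.+2 i; nia. Qed.

Let q_gt1 : 1 < q. Proof. exact: leq_trans le_rq. Qed.

Let Fr2_le : F * r ^ 2 <= r ^ r.-1 * q.
Proof.
have le_F : F <= r ^ i by exact: fact_le_exp.
rewrite mulnA (leq_mul _ le_rq) // /r /= expnS mulnC leq_mul //.
Qed.

(** The classes have size at least n/(q+1), and C(q,r) >= ((q+1)/(r+1))^r, so the Turan number is at
    least (n/(r+1))^r; one factor n is then traded for its lower bound. *)
Lemma turan_number_ge_codegree : (r.+1 ^ 2 + 1) * (s * D) <= turan_number r (n - s) q.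
Proof.
set m := n - s; pose c := m %/ q.
have cq : n <= c * q.+1.
  apply: leq_divn_succ; first by lia.
  apply: (leq_trans _ (ltnW lt_n)); apply: (@leq_trans (8 * 2 * q ^ 3 * s)).
    by rewrite !expnS expn0; nia.
  by rewrite !leq_mul.
have t_ge : n ^ r <= turan_number r m q * r.+1 ^ r.
  apply: (@leq_trans ('C(q, r) * c ^ r * r.+1 ^ r)); last first.
    by rewrite leq_mul2r turan_number_ge ?orbT //; lia.
  rewrite mulnAC; apply: (@leq_trans (q.+1 ^ r * c ^ r)).
    by rewrite -expnMn leq_exp2rW // mulnC.
  by rewrite leq_mul2r -[r.+1]addn1 -[q.+1]addn1 bin_exp_ge ?orbT.
rewrite -(leq_pmul2r (expn_gt0 r.+1 r)) -(leq_pmul2r F_gt0).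
apply: leq_trans (leq_mul t_ge (leqnn F)).
have e1 : r.+1 ^ r <= r.+1 * r ^ r.
  by rewrite -[X in _ ^ X](prednK (ltn0Sn i.+1)) expnS leq_mul2l expS_le_exp.
have le_F : r.-1 <= F by exact: fact_geq.
apply: (@leq_trans ((r.+1 ^ 2 + 1) * s * (r.+1 * r ^ r) * n ^ r.-1)).
  rewrite (_ : _ * F = (r.+1 ^ 2 + 1) * s * r.+1 ^ r * (D * F)); last by lia.
  by apply: leq_mul => //; rewrite leq_mul2l e1 orbT.
apply: (@leq_trans (8 * r ^ r.-1 * q ^ 3 * s * F * n ^ r.-1)); last first.
  by rewrite [n ^ r]expnS mulnAC leq_mul2r leq_mul2r ltnW ?orbT.
rewrite leq_mul2r; apply/orP; right.
have -> : r ^ r = r * r ^ r.-1 by exact: expnS.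
move: (r ^ r.-1) => R.
apply: (@leq_trans ((r.+1 ^ 2 + 1) * r.+1 * r * (R * s))); first by lia.
apply: (@leq_trans (8 * q ^ 3 * F * (R * s))); last by lia.
rewrite leq_mul2r; apply/orP; right.
apply: (@leq_trans (8 * r ^ 3 * r.-1)).
  by rewrite /r /= !expnS expn0; nia.
by apply: leq_mul => //; rewrite leq_mul2l leq_exp2rW ?orbT.
Qed.

(* [F * r ^ 2 * s] is the threshold on [#|nb u :\: nb v|] in [own_lossy].      *)
Lemma turan_number_gap_ge :
  turan_number r (n - s) q.-1 + (F * r ^ 2 * s + s) * D <= turan_number r (n - s) q.
Proof.
set m := n - s; pose p := q.-1; have p_gt0 : 0 < p by lia.
pose alpha := m %/ p.*2; pose a := m %/ p; pose beta := alpha.*2.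
have := turan_number_gap i m p_gt0; rewrite -/r (prednK (ltnW q_gt1)) -/p.
move/(leq_trans _); apply; rewrite leq_add2l -/alpha -/a.
have betaE : q.+1 * n <= beta * q ^ 2.
  apply: leq_divn_double => //; apply: (leq_trans _ (ltnW lt_n)).
  apply: (@leq_trans (8 * 2 * q ^ 3 * s)); last by rewrite !leq_mul.
  by clear -s_gt0 q_gt1; rewrite !expnS expn0; nia.
have a_beta : beta <= a.
  by rewrite /a leq_divRL // /beta /alpha; have := leq_trunc_div m p.*2; lia.
have beta_q : n <= beta * q.
  rewrite -(leq_pmul2r (ltnW q_gt1)) -mulnA mulnn; apply: leq_trans betaE.
  by rewrite mulnC leq_mul2r leqnSn orbT.
(* Squaring [betaE] suffices because (q+1)^2 >= q(q+2). *)
have beta2 : (q + 2) * n ^ 2 <= beta ^ 2 * q ^ 3.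
  rewrite -(leq_pmul2r (ltnW q_gt1)); apply: (@leq_trans ((q.+1 * n) ^ 2)).
    by rewrite expnMn mulnAC leq_mul2r; apply/orP; right; rewrite expnS expn1; nia.
  by apply: leq_trans (leq_exp2rW 2 betaE) _; rewrite expnMn -expnM -mulnA -expnSr.
(* The two halves contribute (beta/2)^2. The other classes contribute at least (n/r)^i, by
   [bin_exp_ge] with shift 2, as q = (p-1) + 2 and r = i + 2. *)
have gap_ge : (q + 2) * n ^ r <=
    4 * q ^ 3 * r ^ i * (alpha ^ 2 * ('C(p.-1, i) * a ^ i)).
  apply: (@leq_trans (beta ^ 2 * q ^ 3 * n ^ i)).
    rewrite (_ : n ^ r = n ^ 2 * n ^ i); last by rewrite -expnD.
    by rewrite mulnA leq_mul2r beta2 orbT.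
  have -> : 4 * q ^ 3 * r ^ i * (alpha ^ 2 * ('C(p.-1, i) * a ^ i)) =
            beta ^ 2 * q ^ 3 * ('C(p.-1, i) * r ^ i * a ^ i).
    by rewrite /beta -mul2n expnMn; lia.
  rewrite leq_mul2l; apply/orP; right.
  apply: (@leq_trans (q ^ i * a ^ i)).
    by rewrite -expnMn leq_exp2rW // mulnC (leq_trans beta_q) // leq_mul2r a_beta orbT.
  have eq_q : q = p.-1 + 2 by rewrite /p; clear -q_gt1; lia.
  have le_ip : i <= p.-1 by rewrite -(leq_add2r 2) -eq_q addn2.
  by rewrite leq_mul2r {1}eq_q /r -[i.+2]addn2 bin_exp_ge ?orbT.
have K_gt0 : 0 < 4 * q ^ 3 * r ^ i * F.
  by rewrite muln_gt0 F_gt0 !muln_gt0 !expn_gt0 (ltnW q_gt1).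
rewrite -(leq_pmul2l K_gt0) [X in _ <= X]mulnAC.
apply: leq_trans (leq_mul gap_ge (leqnn F)).
apply: (@leq_trans (4 * q ^ 3 * r ^ i * (F * r ^ 2 * s + s) * n ^ r.-1)).
  rewrite (_ : _ * _ * _ * F * _ = 4 * q ^ 3 * r ^ i * (F * r ^ 2 * s + s) * (D * F));
    last by lia.
  by rewrite leq_mul2l DF_le orbT.
rewrite [n ^ r]expnS [(q + 2) * _]mulnA [X in _ <= X]mulnAC leq_mul2r; apply/orP; right.
apply: (@leq_trans ((q + 2) * (8 * r ^ r.-1 * q ^ 3 * s) * F)); last first.
  by rewrite leq_mul2r leq_mul2l ltnW ?orbT.
have -> : r ^ r.-1 = r * r ^ i by exact: expnS.
apply: (@leq_trans (4 * q ^ 3 * r ^ i * (2 * (q + 2) * r * s * F))); last by lia.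
rewrite leq_mul2l; apply/orP; right.
apply: (@leq_trans (F * (r ^ 2 + 1) * s)).
  by rewrite mulnDr mulnDl leq_add2l muln1 leq_pmull.
have le_r : r ^ 2 + 1 <= 2 * (q + 2) * r.
  by move: le_rq; rewrite /r; clear; rewrite expnS expn1; nia.
by rewrite -mulnA mulnC !leq_mul2r le_r !orbT.
Qed.

(** Restoring the [F * r ^ 2 * s] missing vertices one at a time adds at least (n/(r+1))^(r-1) edges
    each, while [D] is at most n^(r-1)/F. *)
Lemma turan_number_sub_ge :
  turan_number r (n - s - F * r ^ 2 * s) q + s * D <= turan_number r (n - s) q.
Proof.
set y := F * r ^ 2 * s; pose c := (n - s - y) %/ q.
have le_y : q.+1 * (s + y + q) <= n.
  apply: (leq_trans _ (ltnW lt_n)).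
  apply: (@leq_trans (q.+1 * (s + r ^ r.-1 * q * s + q))).
    by rewrite leq_mul2l /= leq_add2r leq_add2l leq_mul2r Fr2_le orbT.
  move: (r ^ r.-1) R_ge2 q_gt1 s_gt0; clear => R R_ge q_ge s_ge.
  have le1 : s + R * q * s + q <= 2 * (R * q * s).
    have : s + q <= 2 * (q * s) by nia.
    have : 2 * (q * s) <= R * (q * s) by rewrite leq_mul2r R_ge orbT.
    by rewrite -[R * q * s]mulnA; lia.
  have le2 : q.+1 <= 2 * q ^ 2 by rewrite expnS expn1; nia.
  apply: leq_trans (leq_mul le2 le1) _.
  rewrite (_ : _ * _ = 4 * (q ^ 2 * (R * q * s))); last by lia.
  by rewrite (_ : 8 * _ * _ * s = 8 * (q ^ 2 * (R * q * s))) ?leq_mul2r ?orbT //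
     [q ^ 3]expnS; lia.
have cq : n <= c * q.+1 by rewrite /c -subnDA; apply: leq_divn_succ; lia.
have le_syn : s + y <= n.
  by rewrite (leq_trans (leq_addr q _)) // (leq_trans _ le_y) // leq_pmull.
have eq_m : n - s = n - s - y + y.
  by rewrite subnK // leq_subRL // (leq_trans _ le_syn) ?leq_addr.
rewrite [X in _ <= turan_number _ X _]eq_m.
apply: leq_trans (turan_number_addn _ _ _ q_gt1); rewrite leq_add2l -/c.
pose d := 'C(q.-1, r.-1) * c ^ r.-1; rewrite -/d.
have d_ge : n ^ r.-1 <= r.+1 ^ r.-1 * d.
  apply: (@leq_trans (q.+1 ^ r.-1 * c ^ r.-1)).
    by rewrite -expnMn leq_exp2rW // mulnC.
  have eq_q : q.+1 = q.-1 + 2 by rewrite addn2 prednK // ltnW.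
  have le_rq1 : r.-1 <= q.-1 by rewrite -ltnS (prednK (ltnW q_gt1)).
  have eq_r : r.+1 = r.-1 + 2 by rewrite addn2.
  by rewrite /d mulnCA mulnA leq_mul2r {1}eq_q eq_r bin_exp_ge ?orbT.
have K_gt0 : 0 < r.+1 ^ r.-1 * F by rewrite muln_gt0 expn_gt0 F_gt0.
rewrite -(leq_pmul2l K_gt0).
apply: (@leq_trans (r.+1 ^ r.-1 * s * n ^ r.-1)).
  rewrite (_ : _ * F * _ = r.+1 ^ r.-1 * s * (D * F)); last by lia.
  by rewrite leq_mul2l DF_le orbT.
apply: (@leq_trans (F * y * n ^ r.-1)); last first.
  rewrite (_ : _ * F * _ = F * y * (r.+1 ^ r.-1 * d)); last by lia.
  by rewrite leq_mul2l d_ge orbT.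
(* What remains is (r+1)^(r-1) <= F^2 r^2 = (r!)^2, which goes through r^r; hence the factor
   [F * r ^ 2] in the threshold. *)
rewrite leq_mul2r /y mulnA leq_mul2r; apply/orP; right; apply/orP; right.
apply: leq_trans (expS_le_exp (ltn0Sn i.+1)) _.
apply: leq_trans (fact_sqr_ge r) _.
by rewrite factS -/F !expnS !expn0 -/r; lia.
Qed.
End Estimates.

(** * The upper bound *)

Lemma superset_card (T : finType) (A : {set T}) m :
  #|A| <= m <= #|T| -> exists2 S : {set T}, A \subset S & #|S| = m.
Proof.
elim: m => [|m IHm] /andP[le_A le_m].
  by exists A => //; apply/eqP; rewrite -leqn0.
move: le_A; rewrite leq_eqVlt => /predU1P[eq_A|]; first by exists A.
rewrite ltnS => le_A; have [|S sAS card_S] := IHm; first by rewrite le_A ltnW.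
have [x xS] : exists x, x \notin S.
  have [/eqP|[x]] := set_0Vmem (~: S); last by rewrite inE; exists x.
  by rewrite -cards_eq0 cardsCs setCK card_S subn_eq0 leqNgt le_m.
exists (x |: S); last by rewrite cardsU1 xS card_S.
exact: subset_trans sAS (subsetUr _ _).
Qed.

Lemma card_star_le (T : finType) (E : {set {set T}}) (x : T) j :
  {in E, forall e : {set T}, #|e| = j.+1} ->
  #|[set e in E | x \in e]| <= 'C(#|T|, j).
Proof.
move=> card_e; have inj : {in [set e in E | x \in e] &, injective (fun e => e :\ x)}.
  move=> e f; rewrite !inE => /andP[_ xe] /andP[_ xf] eq_ef.
  by rewrite -(setD1K xe) eq_ef setD1K.
rewrite -(card_in_imset inj) -card_draws; apply/subset_leq_card/subsetP.
move=> _ /imsetP[e + ->]; rewrite !inE => /andP[eE xe].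
by move: (card_e e eE); rewrite (cardsD1 x) xe add1n => -[->].
Qed.

Definition shadow (T : finType) (E : {set {set T}}) : rel T :=
  fun x y => [exists e in E, [set x; y] \subset e].

Lemma shadow_sym (T : finType) (E : {set {set T}}) : symmetric (shadow E).
Proof. by move=> x y; apply: eq_existsb => e; rewrite setUC. Qed.

Section UpperBound.
Variables (T : finType) (E : {set {set T}}) (r s q y0 : nat).
Implicit Types (A L M : {set T}) (e f : {set T}) (u v x y : T).

Let D := 'C(#|T|, r.-1).
Let t := turan_number r (#|T| - s) q.
Let adj := shadow E.

Hypotheses (r_gt0 : 0 < r) (q_gt0 : 0 < q) (le_s : s <= #|T|).
Hypothesis card_edge : {in E, forall e, #|e| = r.+1}.
Hypothesis matching_free :
  forall M : {set {set T}}, M \subset E -> trivIset M -> #|M| <= s.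
Hypothesis clique_free : forall L, clique adj L -> #|L| <= q.+1.
Hypothesis t_ge : (r.+1 ^ 2 + 1) * (s * D) <= t.
Hypothesis t_gap : turan_number r (#|T| - s) q.-1 + (y0 + s) * D <= t.
Hypothesis t_sub : turan_number r (#|T| - s - y0) q + s * D <= t.

Let star x := [set e in E | x \in e].
Let star_meet x A := [set e in star x | ~~ [disjoint A & e]].
(** The threshold is the number of edges at [v] that [r.+1 * s] other vertices can block, at most
    [D] for each. *)
Let heavy := [set v | r.+1 * s * D < #|star v|].

Let adj_sym : symmetric adj.
Proof. exact: shadow_sym. Qed.

Let adjI e x y : e \in E -> x \in e -> y \in e -> adj x y.
Proof. by move=> eE xe ye; apply/exists_inP; exists e; rewrite ?subUset ?sub1set ?xe. Qed.

(** An edge through two given vertices is determined by its other [r.-1] vertices, which gives the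
    codegree bound [D]. *)
Let card_star_meet x A : x \notin A -> #|star_meet x A| <= #|A| * D.
Proof.
move=> xA; apply: (@leq_trans #|\bigcup_(a in A) [set e in star x | a \in e]|).
  apply/subset_leq_card/subsetP => e; rewrite !inE => /andP[/andP[eE xe]].
  case/pred0Pn => a /andP[/= Aa ea]; apply/bigcupP; exists a => //.
  by rewrite !inE eE xe ea.
apply: leq_card_bigcup => a Aa; have ax : a != x by apply: contraNneq xA => <-.
have inj : {in [set e in star x | a \in e] &, injective (fun e => e :\ x :\ a)}.
  move=> e f; rewrite !inE => /andP[/andP[_ xe] ea] /andP[/andP[_ xf] fa] eq_ef.
  by rewrite -(setD1K xe) -(@setD1K _ a (e :\ x)) ?inE ?ax // eq_ef !setD1K // !inE ax.
rewrite /D -(card_in_imset inj) -card_draws; apply/subset_leq_card/subsetP.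
move=> _ /imsetP[e + ->]; rewrite !inE => /andP[/andP[/card_edge + xe] ea].
by rewrite (cardsD1 x) xe (cardsD1 a) !inE ax ea /= !add1n => -[<-].
Qed.

(* Greedily, each heavy vertex lies in an edge avoiding any [r.+1 * s] given   *)
(* vertices other than itself.                                                 *)
Let matching_heavy (M : {set {set T}}) A :
  M \subset E -> trivIset M -> A \subset heavy -> [disjoint A & cover M] ->
  #|M| + #|A| <= s.
Proof.
have [b] := ubnP #|A|; elim: b => // b IHb in M A *; rewrite ltnS => le_b.
move=> sM trivM sA dis; have [->|[v Av]] := set_0Vmem A.
  by rewrite cards0 addn0; exact: matching_free.
have lt_A : #|A :\ v| < b by move: le_b; rewrite (cardsD1 v A) Av.
have sA' : A :\ v \subset heavy by rewrite (subset_trans (subD1set _ _)).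
have dis' : [disjoint A :\ v & cover M].
  by apply: disjointWl dis; exact: subD1set.
(* This first use of the induction hypothesis only bounds the set [X] to be avoided; the second, on
   [M] extended by an edge at [v], gives the claim. *)
have le_MA := IHb M (A :\ v) lt_A sM trivM sA' dis'.
pose X := (A :\ v) :|: cover M.
have vM : v \notin cover M by rewrite (disjointFr dis).
have vX : v \notin X by rewrite !inE eqxx vM.
have le_X : #|X| <= r.+1 * s.
  rewrite (leq_trans (leq_card_setU _ _)) //.
  apply: (@leq_trans (#|A :\ v| + #|M| * r.+1)); last first.
    apply: leq_trans (leq_mul (leqnn r.+1) le_MA).
    by rewrite mulnDr addnC [#|M| * _]mulnC leq_add2l leq_pmull.
  rewrite leq_add2l /cover; apply: leq_card_bigcup => e Me.
  by rewrite card_edge // (subsetP sM).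
have [e] : exists2 e, e \in star v & e \notin star_meet v X.
  apply/subsetPn/negP => /subset_leq_card; rewrite leqNgt => /negP; apply.
  rewrite (leq_ltn_trans (card_star_meet vX)) //.
  have : v \in heavy by exact: (subsetP sA).
  by rewrite inE; apply: leq_ltn_trans; rewrite leq_mul2r le_X orbT.
rewrite inE => /andP[eE ve]; rewrite !inE eE ve /= negbK => dis_e.
have disM f : f \in M -> [disjoint e & f].
  move=> Mf; rewrite disjoint_sym; apply: disjointWl dis_e.
  by rewrite subsetU // (bigcup_sup f) ?orbT.
have eM : e \notin M.
  by apply: contraTN ve => Me; rewrite (contraNN _ vM) // => ve; apply/bigcupP; exists e.
have triv' : trivIset (e |: M).
  apply/trivIsetP => f g /setU1P[->|Mf] /setU1P[->|Mg]; rewrite ?eqxx // => ne.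
  - exact: disM.
  - by rewrite disjoint_sym disM.
  by move/trivIsetP: trivM; apply.
have cover' : cover (e |: M) = e :|: cover M by rewrite /cover bigcup_setU big_set1.
have := IHb (e |: M) (A :\ v) lt_A; rewrite cardsU1 eM (cardsD1 v A) Av addnCA addnA.
apply=> //; first by rewrite subUset sub1set eE.
rewrite disjoints_subset cover' setCU subsetI -!disjoints_subset dis' andbT.
by apply: disjointWl dis_e; exact: subsetUl.
Qed.

Let card_heavy : #|heavy| <= s.
Proof.
have := @matching_heavy set0 heavy; rewrite cards0 add0n; apply=> //.
- exact: sub0set.
- by apply/trivIsetP => e f; rewrite inE.
by rewrite /cover big_set0 disjoints_subset setC0 subsetT.
Qed.

(** A maximal matching among these edges has at most [s - #|heavy|] members, by [matching_heavy].
    Each of the edges meets its cover, all of whose vertices have degree at most [r.+1 * s * D]. *)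
Let card_light :
  #|[set e in E | [disjoint heavy & e]]| <= (s - #|heavy|) * (r.+1 ^ 2 * (s * D)).
Proof.
set E0 := [set e in E | _].
pose ok (M : {set {set T}}) := (M \subset E0) && trivIset M.
have ok0 : ok set0 by rewrite /ok sub0set; apply/trivIsetP => e f; rewrite inE.
have [M /maxsetP[/andP[sM trivM] maxM] _] := maxset_exists ok0.
have sME : M \subset E.
  by rewrite (subset_trans sM) //; apply/subsetP => e; rewrite inE => /andP[].
have disM : [disjoint heavy & cover M].
  rewrite disjoint_sym disjoints_subset; apply/subsetP => x /bigcupP[e Me xe].
  have := subsetP sM e Me; rewrite in_set => /andP[_ dis_e].
  by rewrite in_setC (disjointFl dis_e).
have le_M := matching_heavy sME trivM (subxx _) disM.
apply: (@leq_trans #|\bigcup_(x in cover M) star x|).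
  apply/subset_leq_card/subsetP => e E0e; have := E0e; rewrite inE => /andP[eE _].
  have [Me|eM] := boolP (e \in M).
    have [e0|[x xe]] := set_0Vmem e; first by have := card_edge eE; rewrite e0 cards0.
    by apply/bigcupP; exists x; rewrite ?inE ?eE //; apply/bigcupP; exists e.
  have [/pred0P no_x|/pred0Pn[x /andP[xM xe]]] := boolP [disjoint cover M & e]; last first.
    by apply/bigcupP; exists x => //; rewrite inE eE.
  have dis_e f : f \in M -> [disjoint e & f].
    move=> Mf; apply/pred0P => x /=; apply/negP => /andP[xe xf].
    have /= := no_x x; rewrite xe andbT => /negP; apply; apply/bigcupP; by exists f.
  have ok' : ok (e |: M).
    rewrite /ok subUset sub1set E0e sM /=.
    apply/trivIsetP => f g /setU1P[->|Mf] /setU1P[->|Mg]; rewrite ?eqxx // => ne.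
    - exact: dis_e.
    - by rewrite disjoint_sym dis_e.
    by move/trivIsetP: trivM; apply.
  by have := maxM _ ok' (subsetUr _ _); move/setP/(_ e); rewrite setU11 (negPf eM).
have le_cov : #|cover M| <= #|M| * r.+1.
  by apply: leq_card_bigcup => e Me; rewrite card_edge // (subsetP sME).
apply: (@leq_trans (#|cover M| * (r.+1 * s * D))).
  apply: leq_card_bigcup => x xM; have : x \notin heavy by rewrite (disjointFl disM).
  by rewrite inE -leqNgt.
apply: (@leq_trans ((s - #|heavy|) * r.+1 * (r.+1 * s * D))).
  rewrite leq_mul2r (leq_trans le_cov) ?orbT // leq_mul2r.
  by rewrite leq_subRL // addnC le_M orbT.
by rewrite expnS expn1; lia.
Qed.

(** * Counting edges relative to a core of s vertices *)

Section Core.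
Variable S : {set T}.
Hypothesis card_S : #|S| = s.

Let own u := [set e in E | e :&: S == [set u]].
Let nb u := [set x in ~: S | adj u x].

(** Removing [u] from such an edge leaves a clique of the shadow outside [S], inside the
    neighbourhood of [u]. *)
Let card_own u : #|own u| <= #|cliques adj (nb u) r|.
Proof.
have own_u e : e \in own u -> [/\ e \in E, u \in e & forall x, x \in e -> x \in S -> x = u].
  rewrite inE => /andP[eE /eqP/setP eS]; split=> // [|x xe xS].
    by have := eS u; rewrite !inE eqxx => /andP[].
  by have := eS x; rewrite !inE xe xS => /esym/eqP.
have inj : {in own u &, injective (fun e => e :\ u)}.
  move=> e f /own_u[_ ue _] /own_u[_ uf _] eq_ef.
  by rewrite -(setD1K ue) eq_ef setD1K.
rewrite -(card_in_imset inj); apply/subset_leq_card/subsetP.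
move=> _ /imsetP[e /own_u[eE ue eS] ->]; rewrite inE; apply/and3P; split.
- apply/subsetP => x /setD1P[xu xe]; rewrite !inE (adjI eE) // andbT.
  by apply: contraNN xu => /(eS x xe)/eqP.
- by have := card_edge eE; rewrite (cardsD1 u) ue add1n => -[->].
by apply/cliqueP => x y /setD1P[_ xe] /setD1P[_ ye] _; exact: adjI ye.
Qed.

Let nb_clique u L : u \in S -> L \subset nb u -> clique adj L -> #|L| <= q.
Proof.
move=> uS sL cl; have uL : u \notin L.
  by apply/negP => /(subsetP sL); rewrite !inE uS.
rewrite -ltnS; have -> : #|L|.+1 = #|u |: L| by rewrite cardsU1 uL.
apply/clique_free/cliqueU1 => // x /(subsetP sL); by rewrite !inE => /andP[].
Qed.

Let card_CS : #|~: S| = #|T| - s.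
Proof. by rewrite cardsCs setCK card_S. Qed.

Let nb_sub u : nb u \subset ~: S.
Proof. by apply/subsetP => x; rewrite inE => /andP[]. Qed.

Let own_le u : u \in S -> #|own u| <= t.
Proof.
move=> uS; apply: leq_trans (card_own u) _.
apply: leq_trans (@zykov T adj adj_sym q r (nb u) (fun L => @nb_clique u L uS)) _.
by apply: leq_turan_number; rewrite -card_CS subset_leq_card.
Qed.

(* If [nb u :\: nb v] is large then [nb v] is small; otherwise few cliques of  *)
(* [nb u] leave [nb u :&: nb v], which has no clique with [q] vertices.        *)
Let own_lossy u v : u \in S -> v \in S -> u != v -> adj u v ->
  (#|own u| + s * D <= t) || (#|own v| + s * D <= t).
Proof.
move=> uS vS neq_uv ad; pose Y := nb u :\: nb v.
have [le_y|lt_y] := leqP y0 #|Y|; apply/orP; [right|left].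
  apply: leq_trans t_sub; rewrite leq_add2r (leq_trans (card_own v)) //.
  apply: leq_trans (@zykov T adj adj_sym q r (nb v) (fun L => @nb_clique v L vS)) _.
  apply: leq_turan_number; rewrite leq_subRL; last first.
    by rewrite -card_CS (leq_trans le_y) // subset_leq_card // (subset_trans (subsetDl _ _)).
  rewrite -card_CS (leq_trans (_ : _ <= #|Y| + #|nb v|)) ?leq_add2r //.
  rewrite -cardsUI (_ : Y :&: nb v = set0); last first.
    by rewrite /Y setDE -setIA [~: _ :&: _]setIC setICr setI0.
  by rewrite cards0 addn0 subset_leq_card // subUset nb_sub (subset_trans (subsetDl _ _)).
apply: leq_trans t_gap; rewrite mulnDl addnA leq_add2r (leq_trans (card_own u)) //.
pose W := nb u :&: nb v.
apply: (@leq_trans (#|cliques adj W r| + #|Y| * D)); last first.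
  apply: leq_add; last by rewrite leq_mul2r ltnW ?orbT.
  apply: (@leq_trans (turan_number r #|W| q.-1)); last first.
    by apply: leq_turan_number; rewrite -card_CS subset_leq_card // subIset ?nb_sub.
  (* Adding both [u] and [v] to a clique of [W] still gives a clique, so [W] has no clique with [q]
     vertices. *)
  apply: zykov => // L; rewrite subsetI => /andP[sLu sLv] cl.
  have vL : v \notin L by apply/negP => /(subsetP sLv); rewrite !inE vS.
  have : #|v |: L| <= q.
    have uvL : u \notin v |: L.
      rewrite !inE negb_or neq_uv; apply/negP => /(subsetP sLu).
      by rewrite !inE uS.
    rewrite -ltnS; have -> : #|v |: L|.+1 = #|u |: (v |: L)| by rewrite (cardsU1 u) uvL.
    apply/clique_free/cliqueU1 => // [x /setU1P[->|/(subsetP sLu)]|] //.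
      by rewrite !inE => /andP[].
    by apply/cliqueU1 => // x /(subsetP sLv); rewrite !inE => /andP[].
  by move=> le_q; rewrite -ltnS (prednK q_gt0) (leq_trans _ le_q) // cardsU1 vL.
pose hit y := [set e in cliques adj (nb u) r | y \in e].
apply: (@leq_trans #|cliques adj W r :|: \bigcup_(y in Y) hit y|).
  apply/subset_leq_card/subsetP => e eC; rewrite inE.
  have := eC; rewrite inE => /and3P[sN card_e cl].
  have [sW|] := boolP (e \subset W); first by rewrite inE sW card_e cl.
  case/subsetPn => y ye yW; apply/orP; right; apply/bigcupP; exists y.
    by move: yW; rewrite inE [y \in Y]inE (subsetP sN) //= andbT.
  by rewrite inE eC ye.
rewrite (leq_trans (leq_card_setU _ _)) // leq_add2l; apply: leq_card_bigcup => y _.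
by apply: card_star_le => e; rewrite inE (prednK r_gt0) => /and3P[_ /eqP].
Qed.

Let lossy := [set u | #|own u| + s * D <= t].

Lemma card_edges_le_superset : heavy \subset S -> #|E| <= s * t.
Proof.
move=> sHS; have le_h := card_heavy.
have bound u (A : {set T}) : A \subset S -> u \notin A ->
    #|star_meet u A| <= #|A| * D /\ #|A| <= s.
  by move=> sA uA; rewrite card_star_meet // -card_S subset_leq_card.
(* A heavy [u] is charged for its edges that meet [far u]. If [u] is lossy, its deficit [s * D] pays
   for all edges meeting the core again; otherwise it is charged only for those through light core
   vertices. *)
pose far u := if u \in lossy then S :\ u else S :\: heavy.
have far_sub u : far u \subset S by rewrite /far; case: ifP => _; exact: subsetDl.
have le_rest u : u \in heavy ->
    #|own u :|: star_meet u (far u)| <= t + (s - #|heavy|) * D.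
  move=> hu; have uS := subsetP sHS u hu.
  rewrite (leq_trans (leq_card_setU _ _)) // /far.
  have [lu|_] := boolP (u \in lossy).
    have le_u : #|own u| + s * D <= t by rewrite in_set in lu.
    apply: leq_trans (leq_trans le_u (leq_addr _ _)).
    have [||le1 le2] := bound u (S :\ u); rewrite ?subD1set ?setD11 //.
    by rewrite leq_add2l (leq_trans le1) // leq_mul2r le2 orbT.
  have [||le1 _] := bound u (S :\: heavy); rewrite ?subsetDl ?in_setD ?hu //.
  apply: leq_add; first exact: own_le.
  by rewrite (leq_trans le1) // cardsDS // card_S.
pose rest := \bigcup_(u in heavy) (own u :|: star_meet u (far u)).
have sE : E \subset [set e in E | [disjoint heavy & e]] :|: rest.
  apply/subsetP => e eE; rewrite in_setU in_set eE /=.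
  have [//|/pred0Pn[u /andP[/= hu ue]] /=] := boolP [disjoint heavy & e].
  have uS := subsetP sHS u hu; have [own_e|] := boolP (e :&: S == [set u]).
    by apply/bigcupP; exists u; rewrite // in_setU in_set eE own_e.
  rewrite eqEsubset sub1set in_setI ue uS !andbT => /subsetPn[w].
  rewrite in_setI in_set1 => /andP[we wS] neq_wu.
  have meet x y : x \in e -> y \in e -> y \in far x -> e \in star_meet x (far x).
    move=> xe ye yfar; rewrite in_set in_set eE xe /=; apply/pred0Pn; exists y.
    by rewrite /= yfar.
  have in_rest x y : x \in heavy -> x \in e -> y \in e -> y \in far x -> e \in rest.
    move=> hx xe ye yfar; apply/bigcupP; exists x => //.
    by rewrite in_setU (meet x y) ?orbT.
  (* A light [w] lies in [far u] in both cases. If [w] is heavy, the edge is charged to a lossy one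
     among [u] and [w]. *)
  have [hw|hw] := boolP (w \in heavy); last first.
    apply: (in_rest u w) => //; rewrite /far; case: ifP => _.
      by rewrite in_setD1 neq_wu.
    by rewrite in_setD hw.
  have neq_uw : u != w by rewrite eq_sym.
  have := own_lossy uS wS neq_uw (adjI eE ue we); case/orP => ls.
    by apply: (in_rest u w) => //; rewrite /far in_set ls in_setD1 neq_wu.
  by apply: (in_rest w u) => //; rewrite /far in_set ls in_setD1 neq_uw.
apply: (leq_trans (subset_leq_card sE)); rewrite (leq_trans (leq_card_setU _ _)) //.
(* With h heavy vertices the total is at most h(t + (s-h)D) + (s-h)(r+1)^2 s D. As h <= s, [t_ge]
   bounds the terms carrying s - h by (s-h)t. *)
apply: (leq_trans (leq_add card_light (leq_card_bigcup le_rest))).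
rewrite mulnDr addnCA -[X in _ <= X * _](subnKC le_h) mulnDl leq_add2l.
rewrite [#|heavy| * _]mulnCA -mulnDr leq_mul2l (leq_trans _ t_ge) ?orbT //.
by rewrite mulnDl mul1n leq_add2l leq_mul2r le_h orbT.
Qed.
End Core.

Lemma card_edges_le : #|E| <= s * t.
Proof.
have [|S sHS card_S] := @superset_card T heavy s; first by rewrite card_heavy.
exact: card_edges_le_superset card_S sHS.
Qed.

End UpperBound.

(** * The theorem *)

Lemma contains_matching (T : finType) (E M : {set {set T}}) k t :
  0 < k -> {in E, forall e : {set T}, #|e| = k} ->
  M \subset E -> trivIset M -> t.+1 <= #|M| ->
  contains (Hypergraph E) (matching k t.+1).
Proof.
move=> k_gt0 card_e sM trivM le_t.
have [e0 Me0] : exists e, e \in M by apply/set0Pn; rewrite -card_gt0 (leq_trans _ le_t).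
have [x0 _] : exists x, x \in e0 by apply/set0Pn; rewrite -card_gt0 card_e // (subsetP sM).
pose e (i : 'I_t.+1) := nth e0 (enum M) i.
have eM i : e i \in M.
  by rewrite -mem_enum mem_nth // -cardE (leq_trans (ltn_ord i)).
have card_ei i : #|e i| = k by rewrite card_e // (subsetP sM).
pose f (ij : 'I_t.+1 * 'I_k) := nth x0 (enum (e ij.1)) ij.2.
have fe ij : f ij \in e ij.1 by rewrite -mem_enum mem_nth // -cardE card_ei.
have inj : injective f.
  move=> [i j] [i' j'] eq_f; have eq_e : e i = e i'.
    move/trivIsetP: trivM => /(_ _ _ (eM i) (eM i')) dis; apply/eqP/negPn/negP => /dis.
    by move/disjointFr/(_ (fe (i, j))); rewrite eq_f (fe (i', j')).
  have eq_i : i = i'.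
    have /eqP := eq_e; rewrite nth_uniq ?enum_uniq // -?cardE.
    - by move/eqP/val_inj.
    - by rewrite (leq_trans (ltn_ord i)).
    by rewrite (leq_trans (ltn_ord i')).
  subst i'; congr (_, _); move/eqP: eq_f; rewrite /f /= nth_uniq ?enum_uniq //.
  - by move/eqP/val_inj.
  - by rewrite -cardE card_ei.
  by rewrite -cardE card_ei.
exists f; split=> // _ /imsetP[i _ ->]; suff -> : f @: [set x | x.1 == i] = e i.
  exact: (subsetP sM).
apply/eqP; rewrite eqEcard card_imset // card_ei; apply/andP; split.
  by apply/subsetP => _ /imsetP[x + ->]; rewrite inE => /eqP <-.
rewrite -[leqLHS]card_ord -(card_imset _ (f := fun j : 'I_k => (i, j))) => [|a b []//].
by apply/subset_leq_card/subsetP => _ /imsetP[j _ ->]; rewrite inE.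
Qed.

(** One edge chosen for each pair of [p] vertices of the clique gives at most C(p,2) edges, so the
    chosen edges form a member of the family, embedded by the identity. *)
Lemma contains_clique (T : finType) (E : {set {set T}}) k p (L : {set T}) :
  {in E, forall e : {set T}, #|e| = k} -> clique (shadow E) L -> p <= #|L| ->
  exists2 F, clique_family k p F & contains (Hypergraph E) F.
Proof.
move=> card_e /cliqueP cl /card_geqP[sq [uniq_s size_s sL]].
(* The default [set0] is never taken on pairs inside [L'], by [gP]. *)
pose L' := [set x in sq]; pose g (P : {set T}) := odflt set0 [pick e in E | P \subset e].
pose P2 := [set P : {set T} | P \subset L' & #|P| == 2].
have gP P : P \in P2 -> g P \in E /\ P \subset g P.
  rewrite inE => /andP[sPL /cards2P[x [y [neq_xy eq_P]]]].
  have mem z : z \in P -> z \in L by move/(subsetP sPL); rewrite inE => /sL.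
  have /exists_inP[e eE sPe] : shadow E x y by apply: cl; rewrite ?mem // eq_P !inE eqxx ?orbT.
  rewrite /g; case: pickP => [e' /andP[]//|/(_ e)]; by rewrite eE eq_P sPe.
have card_L' : #|L'| = p by rewrite cardsE -size_s; apply/card_uniqP.
exists (@Hypergraph T (g @: P2)); last first.
  exists id; split=> // e /=; rewrite imset_id => /imsetP[P /gP[gE _] ->] //.
split=> /=.
- by apply/forall_inP => _ /imsetP[P /gP[gE _] ->]; rewrite card_e.
- by rewrite (leq_trans (leq_imset_card _ _)) // cards_draws card_L'.
exists L' => // x y xL yL neq_xy.
have P2xy : [set x; y] \in P2 by rewrite inE subUset !sub1set xL yL cards2 neq_xy.
by exists (g [set x; y]); [apply/imsetP; exists [set x; y] | case: (gP _ P2xy)].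
Qed.

(** * The extremal hypergraph: a cone over a Turan hypergraph *)

Section Construction.
Variables (n s r q : nat).
Hypotheses (le_sn : s <= n) (q_gt0 : 0 < q).

Let shift (j : 'I_(n - s)) : 'I_n := cast_ord (subnKC le_sn) (rshift s j).
Let core := [set i : 'I_n | i < s].

Definition turan_cone : {set {set 'I_n}} :=
  [set x |: e | x in core,
                e in [set shift @: (e : {set 'I_(n - s)}) | e in edges (turan r (n - s) q)]].

Let shift_inj : injective shift.
Proof. by move=> i j /cast_ord_inj/rshift_inj. Qed.

Let shift_core j : shift j \notin core.
Proof. by rewrite inE /= -leqNgt leq_addr. Qed.

Let dis_core (e : {set 'I_(n - s)}) : [disjoint core & shift @: e].
Proof.
rewrite disjoint_sym disjoints_subset; apply/subsetP => _ /imsetP[j _ ->].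
by rewrite in_setC shift_core.
Qed.

Let card_core : #|core| = s.
Proof.
rewrite -[RHS]card_ord -(card_imset _ (widen_ord_inj (le_mn := le_sn))).
apply: eq_card => i; rewrite inE; apply/idP/imsetP => [lt_i|[j _ ->]]; last first.
  by rewrite /= ltn_ord.
by exists (Ordinal lt_i) => //; exact: val_inj.
Qed.

Lemma card_turan_cone : #|turan_cone| = s * turan_number r (n - s) q.
Proof.
rewrite card_cone; last by move=> _ /imsetP[e _ ->].
by rewrite card_core card_imset //; exact: imset_inj.
Qed.

Let col (i : 'I_n) := if i < s then q else (i - s) %% q.

Let turan_coneP e : e \in turan_cone ->
  exists2 x, x \in core & [/\ x \in e, #|e| = r.+1 & rainbow col e].
Proof.
case/imset2P => x _ xC /imsetP[e' + ->] ->; rewrite in_turan => /andP[/eqP card_e rain].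
have xe : x \notin shift @: e' by rewrite (disjointFr (dis_core e')).
have col_shift j : col (shift j) = j %% q.
  by have := shift_core j; rewrite inE /col /= => /negPf->; rewrite addKn.
exists x => //; rewrite setU11 cardsU1 xe card_imset // card_e; split=> //.
apply: rainbow_cone => [|_ /imsetP[j _ ->]].
  by apply: rainbow_imset rain => i j; rewrite !col_shift.
rewrite col_shift /col; move: xC; rewrite inE => ->.
by rewrite neq_ltn ltn_pmod.
Qed.

Lemma uniform_turan_cone : uniform r.+1 (Hypergraph turan_cone).
Proof. by apply/forall_inP => e /turan_coneP[x _ [_ ->]]. Qed.

Lemma turan_cone_matching k : 0 < k ->
  ~ contains (Hypergraph turan_cone) (matching k s.+1).
Proof.
move=> k_gt0 [f [inj fE]].
have hit (i : 'I_s.+1) : exists j : 'I_k, f (i, j) \in core.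
  have := fE [set x | x.1 == i]; case/(_ _)/turan_coneP => [|x xC [xe _ _]].
    exact: imset_f.
  by move: xe xC => /imsetP[[i' j]]; rewrite inE /= => /eqP -> ->; exists j.
pose h i := f (i, xchoose (hit i)).
have h_inj : injective h by move=> i i' /inj[].
have : #|h @: 'I_s.+1| <= #|core|.
  by apply/subset_leq_card/subsetP => _ /imsetP[i _ ->]; exact: xchooseP (hit i).
by rewrite card_imset // card_ord card_core ltnn.
Qed.

(** Two vertices in a common edge have different colours under [col], so the image of [L] would be a
    rainbow set of [q.+2] vertices in [q.+1] colours. *)
Lemma turan_cone_clique k F : clique_family k q.+2 F ->
  ~ contains (Hypergraph turan_cone) F.
Proof.
case=> _ _ [L card_L cov] [f [inj fE]].
suff : #|f @: L| <= q.+1 by rewrite card_imset // card_L ltnn.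
apply: (@leq_card_rainbow _ col); last first.
  by move=> x _; rewrite /col; case: ifP => // _; rewrite leqW // ltn_pmod.
apply/rainbowP => _ _ /imsetP[x xL ->] /imsetP[y yL ->] eq_col.
have [->//|neq_xy] := eqVneq x y; have [e eF sxy] := cov x y xL yL neq_xy.
have [_ _ [_ _ /rainbowP rain]] := turan_coneP (fE e eF).
by apply: rain; rewrite // imset_f // (subsetP sxy) ?set21 ?set22.
Qed.

End Construction.

Theorem theorem1p9 (n s k l : nat) (hlk : k <= l) (hk : 3 <= k) (hs : 1 <= s)
  (hsn : (s%:R < n%:R / (8 * (k - 1) ^ (k - 2) * (l - 1) ^ 3)%N%:R :> rat)%R) :
  ex_num k n (fun F => clique_family k l.+1 F \/ F = matching k s.+1) =
  s * turan_number (k - 1) (n - s) (l - 1).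
Proof.
case: k hk hlk hsn => [|[|[|i]]] // _ hlk hsn; case: l hlk hsn => // q.
rewrite !subSS !subn0 => le_rq hsn.
have {}le_rq : i.+2 <= q by [].
have q_gt1 : 1 < q by exact: leq_trans le_rq.
have lt_n : 8 * i.+2 ^ i.+1 * q ^ 3 * s < n.
  move: hsn; rewrite Num.Theory.ltr_pdivlMr ?Num.Theory.ltr0n
    ?muln_gt0 ?expn_gt0 ?(ltnW q_gt1) //.
  by rewrite -GRing.natrM Num.Theory.ltr_nat mulnC.
have le_sn : s <= n.
  by rewrite (leq_trans _ (ltnW lt_n)) // leq_pmull // !muln_gt0 !expn_gt0 (ltnW q_gt1).
apply/eqP; rewrite eqn_leq; apply/andP; split.
  apply/bigmax_leqP => E /andP[/forall_inP unif /asboolP free_E].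
  have card_e : {in E, forall e : {set 'I_n}, #|e| = i.+3} by move=> e /unif/eqP.
  (* The threshold [y0] is set to (r-1)! r^2 s with r = i + 2, the value for which both
     [turan_number_gap_ge] and [turan_number_sub_ge] hold. *)
  have := @card_edges_le _ E i.+2 s q (i.+1`! * i.+2 ^ 2 * s).
  rewrite card_ord; apply=> //.
  - exact: ltnW.
  - move=> M sM trivM; rewrite leqNgt; apply/negP => lt_M.
    apply: (free_E (matching i.+3 s.+1)); first by right.
    exact: contains_matching sM trivM lt_M.
  - move=> L cl; rewrite leqNgt; apply/negP => lt_L.
    have [F famF cF] := contains_clique card_e cl lt_L.
    by apply: (free_E F) => //; left.
  - exact: turan_number_ge_codegree.
  - exact: turan_number_gap_ge.
  exact: turan_number_sub_ge.
rewrite -(card_turan_cone i.+2 q le_sn); apply: leq_bigmax_cond.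
rewrite uniform_turan_cone ?(ltnW q_gt1) //=; apply/asboolP => F [famF|->].
  by apply: turan_cone_clique famF; exact: ltnW.
by apply: turan_cone_matching => //; exact: ltnW.
Qed.
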